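(* Let $k\ge 0$ be an integer and let $(f_h^m,E_h^m)_{m=0}^{M}$ be generated by the (second-order, Strang-splitting) ECSLDG method with polynomial degree $k$ for the 1D1V Vlasov-Ampère system, periodic in $x$, on $[0,L]\times[-v_m,v_m]$. Then the method is $L^2$ stable: for every $m=0,\dots,M-1$, $$\int_0^L\int_{-v_m}^{v_m} |f_h^{m+1}(x,v)|^2\,dv\,dx\le\int_0^L\int_{-v_m}^{v_m} |f_h^{m}(x,v)|^2\,dv\,dx .$$
   Context: Continuous problem (dimensionless, electrons only): $\partial_t f+v\,\partial_x f-E\,\partial_v f=0$, $\lambda^2\partial_t E=-J$ with $J=-\int f v\,dv$, $\lambda>0$ constant, periodic in $x\in[0,L]$, velocity domain $[-v_m,v_m]$. (In the symbol $v_m$ for the velocity cutoff, the subscript is not the time index.) Mesh and spaces. $0=x_{1/2}<\dots<x_{N_x+1/2}=L$, $X_i=[x_{i-1/2},x_{i+1/2}]$; $-v_m=v_{1/2}<\dots<v_{N_v+1/2}=v_m$, $V_j=[v_{j-1/2},v_{j+1/2}]$. $\mathcal D_k(\mathcal E_x)$ (resp. $\mathcal D_k(\mathcal E_v)$) is the space of functions, possibly discontinuous at cell interfaces, whose restriction to each $X_i$ (resp. $V_j$) is a polynomial of degree at most $k$; $Q^k=\mathcal D_k(\mathcal E_x)\otimes\mathcal D_k(\mathcal E_v)$. On each $X_i$ (resp. $V_j$) let $x_{i,p}$ with weights $w_{i,p}$, $p=1,\dots,k+1$ (resp. $v_{j,q}$ with weights $w_{j,q}$, $q=1,\dots,k+1$)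 be the $(k+1)$-point Gauss-Legendre nodes and weights of that cell, so quadrature is exact for polynomials of degree less than $2k+2$. An element of $Q^k$ is determined by its values at all nodes $(x_{i,p},v_{j,q})$, equivalently by its restrictions to all lines $v=v_{j,q}$, or to all lines $x=x_{i,p}$. An element of $\mathcal D_k(\mathcal E_x)$ is determined by its values at all $x_{i,p}$. Functions of $x$ are extended $L$-periodically; functions of $v$ are extended by zero outside $[-v_m,v_m]$. ECSLDG method. Time step $\Delta t>0$. Given $f_h^m\in Q^k$ and $E_h^m\in\mathcal D_k(\mathcal E_x)$, define $f_h^{m+1}\in Q^k$, $E_h^{m+1}\in\mathcal D_k(\mathcal E_x)$ by three steps. Step 1: for each $(j,q)$, $f_h^*(\cdot,v_{j,q})\in\mathcal D_k(\mathcal E_x)$ is defined by $$\int_{X_i} f_h^*(x,v_{j,q})\Psi(x)\,dx=\int_{X_i^\star} f_h^m(x,v_{j,q})\Psi(x+v_{j,q}\Delta t/2)\,dx,\quad X_i^\star=X_i-v_{j,q}\Delta t/2,$$ for all $i$ and all $\Psi\in\mathcal D_k(\mathcal E_x)$ (in the right-hand integral, $\Psi$ is evaluated at points of the cell $X_i$). This determines $f_h^*\in Q^k$. Step 2: for each $(i,p)$ let $n_h^*(x_{i,p})=\sum_{j,q}w_{j,q}f_h^*(x_{i,p},v_{j,q})$, $J_h^*(x_{i,p})=-\sum_{j,q}w_{j,q}f_h^*(x_{i,p},v_{j,q})v_{j,q}$, $\theta(x_{i,p})=\frac{\Delta t^2}{4}n_h^*(x_{i,p})$, $$E_h^{m+1}(x_{i,p})=\frac{\lambda^2-\theta(x_{i,p})}{\lambda^2+\theta(x_{i,p})}E_h^m(x_{i,p})-\frac{\Delta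 t}{\lambda^2+\theta(x_{i,p})}J_h^*(x_{i,p}),\quad E_h^{m+1/2}=\tfrac12(E_h^m+E_h^{m+1}),$$ where it is assumed that $\lambda^2+\theta(x_{i,p})\neq 0$, so that the update is defined. Then $f_h^{**}(x_{i,p},\cdot)\in\mathcal D_k(\mathcal E_v)$ is defined by $$\int_{V_j} f_h^{**}(x_{i,p},v)\Psi(v)\,dv=\int_{V_j^\star} f_h^*(x_{i,p},v)\Psi(v-E_h^{m+1/2}(x_{i,p})\Delta t)\,dv,\quad V_j^\star=V_j+E_h^{m+1/2}(x_{i,p})\Delta t,$$ for all $j$ and all $\Psi\in\mathcal D_k(\mathcal E_v)$ (with $\Psi$ evaluated at points of the cell $V_j$). This determines $f_h^{**}\in Q^k$. Step 3: $f_h^{m+1}$ is obtained from $f_h^{**}$ exactly as $f_h^*$ is obtained from $f_h^m$ in Step 1; $E_h^{m+1}$ is unchanged. Standing assumption (compact support in velocity, $v_m$ sufficiently large): at every time step and every node $x_{i,p}$, $f_h^*(x_{i,p},\cdot)$, extended by zero, vanishes (almost everywhere) outside $\bigcup_j V_j^\star=[-v_m+E_h^{m+1/2}(x_{i,p})\Delta t,\;v_m+E_h^{m+1/2}(x_{i,p})\Delta t]$, so no mass leaves the velocity domain. *)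

(* Defs.v *)
From HB Require Import structures.
From mathcomp Require Import all_boot all_order all_algebra.
From mathcomp Require Import all_classical all_reals all_analysis.

Set Implicit Arguments.
Unset Strict Implicit.
Unset Printing Implicit Defensive.

Import Order.TTheory GRing.Theory Num.Theory.
Import numFieldNormedType.Exports.

Local Open Scope classical_set_scope.
Local Open Scope ring_scope.

(** Rodrigues' formula. *)
Definition legendre (R : realType) (n : nat) : {poly R} :=
  (2 ^+ n * n`!%:R)^-1 *: (('X ^+ 2 - 1) ^+ n)^`(n).

(** A mesh of [a, b]; cells are numbered from 0, so that cell [i] is
    [pt i, pt i.+1], and [pt] is only meaningful up to index [ncell]. The
    [k.+1] nodes of a cell are the affine images of the roots of the Legendre
    polynomial of degree [k.+1]; no order on them is assumed. *)
Record gl_mesh (R : realType) (k : nat) (a b : R) := GLMesh {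
  ncell : nat;
  pt : nat -> R;
  pt_first : pt 0%N = a;
  pt_last : pt ncell = b;
  pt_lt : forall i : 'I_ncell, pt i < pt i.+1;
  node : 'I_ncell -> 'I_k.+1 -> R;
  node_inj : forall i, injective (node i);
  node_in : forall i p, node i p \in `]pt i, pt i.+1[;
  node_root : forall i p,
    root (legendre R k.+1)
      ((2 * node i p - (pt i + pt i.+1)) / (pt i.+1 - pt i))
}.

Section ECSLDG.
Context {R : realType}.
Local Notation mu := (@lebesgue_measure R).

Section Mesh.
Context {k : nat} {a b : R} (G : gl_mesh k a b).

Definition cell (i : 'I_(ncell G)) : set R := `[pt G i, pt G i.+1].

Definition cell_shift (s : R) (i : 'I_(ncell G)) : set R :=
  `[pt G i + s, pt G i.+1 + s].

(** Quadrature weight: the integral of the Lagrange basis polynomial. *)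
Definition weight (i : 'I_(ncell G)) (p : 'I_k.+1) : R :=
  \int[mu]_(x in cell i)
    \prod_(q < k.+1 | q != p) ((x - node i q) / (node i p - node i q)).

(** The values at the cell interfaces are arbitrary: elements of this space
    are two-valued there. No node lies on an interface, and no integral below
    depends on these values. *)
Definition in_D (u : R -> R) : Prop :=
  forall i : 'I_(ncell G), exists p : {poly R},
    (size p <= k.+1)%N /\
    forall x, x \in `]pt G i, pt G i.+1[ -> u x = p.[x].

End Mesh.

(** The periodic extension of the restriction of [u] to [0, L[. *)
Definition periodic_ext (L : R) (u : R -> R) (x : R) : R :=
  u (x - (Num.floor (x / L))%:~R * L).

(** The extension by zero of the restriction of [u] to [-vm, vm]. *)
Definition zero_ext (vm : R) (u : R -> R) (v : R) : R :=
  if v \in `[- vm, vm] then u v else 0.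

Section Scheme.
Context {k : nat} {L vm : R}.
Variables (X : gl_mesh k 0 L) (V : gl_mesh k (- vm) vm) (lam dt : R).

Definition in_Q (f : R -> R -> R) : Prop :=
  exists (n : nat) (u w : 'I_n -> R -> R),
    [/\ forall l, in_D X (u l),
        forall l, in_D V (w l) &
        forall x v, x \in `[0, L] -> v \in `[- vm, vm] ->
          f x v = \sum_(l < n) u l x * w l v].

(** [g] is obtained from [f] by free streaming over [dt / 2]. *)
Definition x_step (f g : R -> R -> R) : Prop :=
  in_Q g /\
  forall (j : 'I_(ncell V)) (q : 'I_k.+1) (i : 'I_(ncell X)) (Psi : R -> R),
    in_D X Psi ->
    let vjq := node j q in
    let s := vjq * dt / 2 in
    \int[mu]_(x in cell i) (g x vjq * Psi x) =
    \int[mu]_(x in cell_shift (- s) i)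
      (periodic_ext L (fun y => f y vjq) x * Psi (x + s)).

Definition density (f : R -> R -> R) (x : R) : R :=
  \sum_(j < ncell V) \sum_(q < k.+1) weight j q * f x (node j q).

Definition current (f : R -> R -> R) (x : R) : R :=
  - \sum_(j < ncell V) \sum_(q < k.+1)
      weight j q * f x (node j q) * node j q.

Definition theta (f : R -> R -> R) (x : R) : R := dt ^+ 2 / 4 * density f x.

(** The update of the electric field from [E] to [E'], including the
    assumption that it is well defined. *)
Definition E_step (f : R -> R -> R) (E E' : R -> R) : Prop :=
  in_D X E' /\
  forall (i : 'I_(ncell X)) (p : 'I_k.+1),
    let x := node i p in
    lam ^+ 2 + theta f x != 0 /\
    E' x = (lam ^+ 2 - theta f x) / (lam ^+ 2 + theta f x) * E x
           - dt / (lam ^+ 2 + theta f x) * current f x.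

Definition E_half (E E' : R -> R) (x : R) : R := (E x + E' x) / 2.

(** [g] is obtained from [f] by advection in velocity over [dt] with the
    field [Eh]. *)
Definition v_step (Eh : R -> R) (f g : R -> R -> R) : Prop :=
  in_Q g /\
  forall (i : 'I_(ncell X)) (p : 'I_k.+1) (j : 'I_(ncell V)) (Psi : R -> R),
    in_D V Psi ->
    let xip := node i p in
    let s := Eh xip * dt in
    \int[mu]_(v in cell j) (g xip v * Psi v) =
    \int[mu]_(v in cell_shift s j) (zero_ext vm (f xip) v * Psi (v - s)).

(** No mass leaves the velocity domain during the velocity advection. *)
Definition compact_support (Eh : R -> R) (f : R -> R -> R) : Prop :=
  forall (i : 'I_(ncell X)) (p : 'I_k.+1),
    let xip := node i p in
    let s := Eh xip * dt in
    {ae mu, forall v, v \notin `[- vm + s, vm + s] ->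
                      zero_ext vm (f xip) v = 0}.

(** [fs] and [fss] are the two intermediate distribution functions. *)
Definition ecsldg_step (f : R -> R -> R) (E : R -> R)
    (f' : R -> R -> R) (E' : R -> R) : Prop :=
  exists fs fss : R -> R -> R,
    [/\ x_step f fs,
        E_step fs E E',
        compact_support (E_half E E') fs,
        v_step (E_half E E') fs fss &
        x_step fss f'].

Definition ecsldg_run (M : nat) (f : nat -> R -> R -> R) (E : nat -> R -> R) :
    Prop :=
  [/\ in_Q (f 0%N), in_D X (E 0%N) &
      forall m, (m < M)%N -> ecsldg_step (f m) (E m) (f m.+1) (E m.+1)].

End Scheme.
End ECSLDG.

(* Main.v *)
From HB Require Import structures.
Require Import Defs.
From mathcomp Require Import all_boot all_order all_algebra.
From mathcomp Require Import all_classical all_reals all_analysis.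
From mathcomp Require Import measurable_realfun ring lra.

Set Implicit Arguments.
Unset Strict Implicit.
Unset Printing Implicit Defensive.

Import Order.TTheory GRing.Theory Num.Theory.
Import numFieldNormedType.Exports.
Local Open Scope classical_set_scope.
Local Open Scope ring_scope.

(** Since Gauss-Legendre quadrature with [k.+1] nodes per cell is exact up to
    degree [2 k + 1] and has nonnegative weights, the squared [L2] norm of an
    element of the space [in_Q] is the weighted sum of the squared norms of its
    restrictions to the lines [v = v_jq], and also to the lines [x = x_ip]
    ([L2sq_lines_x], [L2sq_lines_v]). A substep in [x] or in [v] acts on each
    such line separately, so it is enough to treat a single line.

    On a line the new function [g] is the cellwise [L2] projection of a
    translate of the old function [h]. Testing with [g] itself,
    [int_C g^2 = int_(C + s) h(x) g(x - s)
    <= (int_(C + s) h^2 + int_C g^2) / 2], hence [int_C g^2 <= int_(C + s) h^2]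
    on every cell [C]; summed over the cells, the norm of [g] is at most that of
    [h] on the translated domain ([projection_contraction]). For the
    [L]-periodic extension the translated domain carries the same norm as one
    period, and for the extension by zero it carries at most the norm on the
    original domain. The electric field enters only through the length of the
    translation, so each substep is a contraction whatever the field is.

    Exactness of the quadrature ([gauss_quadrature]) rests on the fact that the
    monic polynomial vanishing at the nodes is orthogonal on the cell to
    polynomials of degree at most [k]: by Rodrigues' formula it is a multiple
    of the derivative of order [k.+1] of [((x - c) (x - d)) ^+ k.+1], and one
    integrates by parts. Nonnegativity of the weights follows, because a weight
    is also the integral of the square of a Lagrange polynomial. *)

(** * Iterated derivatives of polynomials *)

Lemma derivn_comp_affine (R : comNzRingType) (p : {poly R}) (s t : R) n :
  (p \Po (s *: 'X + t%:P))^`(n) = s ^+ n *: (p^`(n) \Po (s *: 'X + t%:P)).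
Proof.
elim: n => [|n IHn]; first by rewrite expr0 scale1r.
rewrite derivnS IHn derivZ deriv_comp -derivnS derivD derivZ derivX derivC.
by rewrite addr0 -scalerAr mulr1 scalerA -exprSr.
Qed.

Lemma derivn_multiple_root (R : comNzRingType) (q : {poly R}) (c : R) N n :
  (n <= N)%N ->
  exists r, (q * ('X - c%:P) ^+ N)^`(n) = r * ('X - c%:P) ^+ (N - n).
Proof.
elim: n => [|n IHn] ltnN; first by exists q; rewrite subn0.
have [r] := IHn (ltnW ltnN); rewrite derivnS => ->.
rewrite -(subnSK ltnN); set m := (N - n.+1)%N.
exists (r^`() * ('X - c%:P) + r *+ m.+1).
rewrite derivM deriv_exp derivXsubC mul1r /= exprS; ring.
Qed.

(** Used for the boundary terms of the integrations by parts. *)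
Lemma derivn_root0 (R : comNzRingType) (q : {poly R}) (c : R) N n :
  (n < N)%N -> (q * ('X - c%:P) ^+ N)^`(n).[c] = 0.
Proof.
move=> ltnN; have [r ->] := derivn_multiple_root q c (ltnW ltnN).
rewrite hornerM horner_exp hornerXsubC subrr expr0n subn_eq0 leqNgt ltnN.
by rewrite mulr0.
Qed.

(** * Gauss-Legendre quadrature on an interval *)

Section IntegralPoly.
Variables (R : realType) (c d : R).
Hypothesis ltcd : c < d.
Local Notation mu := (@lebesgue_measure R).

Lemma integrable_horner (p : {poly R}) :
  mu.-integrable `[c, d] (EFin \o horner p).
Proof.
apply: continuous_compact_integrable; first exact: segment_compact.
by apply: continuous_subspaceT => x; exact: continuous_horner.
Qed.

Definition poly_integral (p : {poly R}) : R := \int[mu]_(x in `[c, d]) p.[x].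

Lemma poly_integralD p q :
  poly_integral (p + q) = poly_integral p + poly_integral q.
Proof.
rewrite /poly_integral -RintegralD //; [|exact: integrable_horner..].
by apply: eq_Rintegral => x _; rewrite hornerD.
Qed.

Lemma poly_integralZ t p : poly_integral (t *: p) = t * poly_integral p.
Proof.
rewrite /poly_integral -RintegralZl //; last exact: integrable_horner.
by apply: eq_Rintegral => x _; rewrite hornerZ.
Qed.

Lemma poly_integral0 : poly_integral 0 = 0.
Proof. by rewrite -(scale0r 0) poly_integralZ mul0r. Qed.

Lemma poly_integral_sum (I : finType) (F : I -> {poly R}) :
  poly_integral (\sum_i F i) = \sum_i poly_integral (F i).
Proof.
exact: (big_morph poly_integral poly_integralD poly_integral0).
Qed.

Lemma poly_integral_deriv p : poly_integral p^`() = p.[d] - p.[c].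
Proof.
rewrite /poly_integral /Rintegral (@continuous_FTC2 _ _ (horner p)) //.
- by apply: continuous_subspaceT => x; exact: continuous_horner.
- split=> [x _||]; first exact: derivable_horner.
  + apply: cvg_at_right_filter; exact: continuous_horner.
  + apply: cvg_at_left_filter; exact: continuous_horner.
- by move=> x _; rewrite derivE.
Qed.

(** The polynomial of Rodrigues' formula transported to [c, d], up to a
    scalar. *)
Let bump N : {poly R} := (('X - c%:P) * ('X - d%:P)) ^+ N.

(** Each integration by parts moves a derivative from [bump N] to [q]; as the
    derivatives of [bump N] of order less than [N] vanish at [c] and [d], there
    are no boundary terms, and [q] is eventually differentiated to [0]. *)
Lemma poly_integral_bump_orthogonal N n (q : {poly R}) :
  (size q <= n)%N -> (n <= N)%N -> poly_integral (q * (bump N)^`(n)) = 0.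
Proof.
elim: n q => [|n IHn] q sq lenN.
  move: sq; rewrite leqn0 size_poly_eq0 => /eqP ->.
  by rewrite mul0r poly_integral0.
have bc : (bump N)^`(n).[c] = 0 by rewrite /bump exprMn mulrC derivn_root0.
have bd : (bump N)^`(n).[d] = 0 by rewrite /bump exprMn derivn_root0.
have := poly_integral_deriv (q * (bump N)^`(n)).
rewrite !hornerM bc bd !mulr0 subr0 derivM poly_integralD -derivnS.
rewrite IHn ?add0r // ?(ltnW lenN) //.
have [->|q0] := eqVneq q 0; first by rewrite deriv0 size_poly0.
by rewrite -ltnS (leq_trans (lt_size_deriv q0)).
Qed.

Variables (k : nat) (node : 'I_k.+1 -> R).
Hypothesis node_inj : injective node.
Hypothesis node_root : forall p, root (legendre R k.+1)
  ((2 * node p - (c + d)) / (d - c)).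

Let nodal : {poly R} := \prod_(p < k.+1) ('X - (node p)%:P).

(** The affine map sending [c, d] to [-1, 1] turns [X^2 - 1] into a multiple of
    [(X - c) (X - d)], so the nodes are the roots of the derivative of order
    [k.+1] of [bump k.+1]. *)
Lemma root_bump p : root ((bump k.+1)^`(k.+1)) (node p).
Proof.
have dc0 : d - c != 0 by rewrite subr_eq0 gt_eqF.
pose s := 2 / (d - c); pose t := - (c + d) / (d - c).
have s0 : s != 0 by rewrite mulf_neq0 ?invr_eq0 // pnatr_eq0.
have Ecomp : (('X ^+ 2 - 1) ^+ k.+1 \Po (s *: 'X + t%:P))
    = (s ^+ 2) ^+ k.+1 *: bump k.+1.
  rewrite rmorphXn rmorphB rmorphXn rmorph1 /= comp_polyX -exprZn.
  congr (_ ^+ _); rewrite -!mul_polyC.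
  have Es : s%:P * c%:P + t%:P = -1 :> {poly R}.
    by rewrite -polyCM -polyCD -polyCN; congr _%:P; rewrite /s /t; field.
  have Et : s%:P * d%:P + t%:P = 1 :> {poly R}.
    by rewrite -polyCM -polyCD; congr _%:P; rewrite /s /t; field.
  rewrite subr_sqr_1 [s ^+ 2]expr2 (polyCM s s).
  have -> : s%:P * 'X + t%:P - 1 = s%:P * ('X - d%:P) by rewrite -Et; ring.
  have -> : s%:P * 'X + t%:P + 1 = s%:P * ('X - c%:P).
    by rewrite -[1]opprK -Es; ring.
  ring.
have := derivn_comp_affine (('X ^+ 2 - 1) ^+ k.+1) s t k.+1.
rewrite Ecomp derivnZ => /(congr1 (horner^~ (node p))).
rewrite !hornerZ horner_comp !hornerE.
have -> : s * node p + t = (2 * node p - (c + d)) / (d - c).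
  by rewrite /s /t; field.
have := node_root p; rewrite /legendre /root hornerZ mulf_eq0 => /orP[|/eqP ->].
  rewrite invr_eq0 mulf_eq0 expf_eq0 !pnatr_eq0 andbF /=.
  by rewrite eqn0Ngt fact_gt0.
by rewrite mulr0 => /eqP; rewrite mulf_eq0 !expf_eq0 (negbTE s0) !andbF.
Qed.

(** The derivative of order [k.+1] of [bump k.+1] has degree [k.+1] and [k.+1]
    distinct roots at the nodes: it is a nonzero multiple of [nodal]. *)
Lemma nodal_orthogonal (q : {poly R}) :
  (size q <= k.+1)%N -> poly_integral (q * nodal) = 0.
Proof.
move=> sq; set D := (bump k.+1)^`(k.+1).
have lead_bump : lead_coef (bump k.+1) = 1.
  by rewrite lead_coef_exp lead_coefM !lead_coefXsubC mulr1 expr1n.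
have deg_bump : (size (bump k.+1)).-1 = (k.+1 + k.+1)%N.
  by rewrite size_exp size_mul ?polyXsubC_eq0 // !size_XsubC /= mul2n addnn.
have sD : size D = k.+2.
  apply/eqP; rewrite eqn_leq; apply/andP; split.
    apply/leq_sizeP => j ltkj; rewrite coef_derivn nth_default ?mul0rn //.
    by rewrite (leq_trans (leqSpred _)) // deg_bump -addnS leq_add2l.
  rewrite ltnNge; apply/negP => /leq_sizeP/(_ _ (leqnn _))/eqP.
  rewrite coef_derivn -deg_bump -lead_coefE lead_bump pnatr_eq0.
  by rewrite eqn0Ngt ffact_gt0 deg_bump leq_addr.
have rD : all (root D) [seq node p | p : 'I_k.+1].
  by apply/allP => _ /mapP[p _ ->]; exact: root_bump.
have uD : uniq_roots [seq node p | p : 'I_k.+1].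
  by rewrite uniq_rootsE map_inj_uniq ?enum_uniq.
have := @all_roots_prod_XsubC _ D _ _ rD uD.
rewrite size_map -cardE card_ord => /(_ sD).
rewrite big_map big_enum /= -/nodal => ED.
have lD : lead_coef D != 0 by rewrite lead_coef_eq0 -size_poly_eq0 sD.
have := poly_integral_bump_orthogonal sq (leqnn _).
rewrite -/D ED -scalerAr poly_integralZ => /eqP.
by rewrite mulf_eq0 (negbTE lD) => /eqP.
Qed.

Definition lagrange p : {poly R} :=
  \prod_(q < k.+1 | q != p) ((node p - node q)^-1 *: ('X - (node q)%:P)).

Lemma horner_lagrange p x :
  (lagrange p).[x] =
  \prod_(q < k.+1 | q != p) ((x - node q) / (node p - node q)).
Proof.
rewrite horner_prod; apply: eq_bigr => q _.
by rewrite hornerZ hornerXsubC mulrC.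
Qed.

Lemma lagrange_node p q : (lagrange p).[node q] = (q == p)%:R.
Proof.
rewrite horner_lagrange; have [->|neq] := eqVneq q p.
  apply: big1 => r rp; rewrite divff // subr_eq0.
  by rewrite (inj_eq node_inj) eq_sym.
by rewrite (bigD1 q) //= subrr mul0r mul0r.
Qed.

Lemma size_lagrange p : (size (lagrange p) <= k.+1)%N.
Proof.
have card_others : #|[pred q | q != p]| = k.
  by rewrite -[LHS]/#|predC1 p| cardC1 card_ord.
apply: leq_trans (size_poly_prod_leq _ _) _; rewrite card_others leq_subLR.
rewrite addnS ltnS -[X in (_ <= X + X)%N]card_others addnn -mul2n mulnC.
rewrite -sum_nat_const.
apply: leq_sum => q _.
by rewrite (leq_trans (size_scale_leq _ _)) ?size_XsubC.
Qed.

Lemma lagrange_interpolation (r : {poly R}) : (size r <= k.+1)%N ->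
  r = \sum_p r.[node p] *: lagrange p.
Proof.
move=> sr; apply/eqP; rewrite -subr_eq0; set e := _ - _.
apply/negPn/negP => e0.
have se : (size e <= k.+1)%N.
  rewrite (leq_trans (size_polyD _ _)) // geq_max sr size_polyN.
  apply: (leq_trans (size_sum _ _ _)); apply/bigmax_leqP => p _.
  by rewrite (leq_trans (size_scale_leq _ _)) // size_lagrange.
have re : all (root e) [seq node p | p : 'I_k.+1].
  apply/allP => _ /mapP[p _ ->]; rewrite /root /e hornerD hornerN horner_sum.
  rewrite (bigD1 p) //= big1 ?addr0 => [|q qp].
    by rewrite hornerZ lagrange_node eqxx mulr1 subrr.
  by rewrite hornerZ lagrange_node eq_sym (negbTE qp) mulr0.
have ue : uniq [seq node p | p : 'I_k.+1].
  by rewrite map_inj_uniq ?enum_uniq.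
by have := max_poly_roots e0 re ue; rewrite size_map -cardE card_ord ltnNge se.
Qed.

(** Divide [r] by [nodal]: the quotient has degree at most [k], so its product
    with [nodal] has integral [0] by orthogonality, and the remainder takes the
    values of [r] at the nodes and is recovered from them by interpolation. *)
Theorem gauss_quadrature (r : {poly R}) : (size r <= k.+1 + k.+1)%N ->
  poly_integral r = \sum_p poly_integral (lagrange p) * r.[node p].
Proof.
move=> sr.
have nm : nodal \is monic by apply: monic_prod => p _; exact: monicXsubC.
have sn : size nodal = k.+2.
  by rewrite /nodal -big_enum size_prod_XsubC size_enum_ord.
have n0 : nodal != 0 by exact: monic_neq0.
have rn p : nodal.[node p] = 0.
  by apply/eqP; rewrite horner_prod (bigD1 p) //= hornerXsubC subrr mul0r.
rewrite (divp_eq r nodal) poly_integralD nodal_orthogonal ?add0r; last first.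
  by rewrite size_divp // sn /= leq_subLR.
rewrite {1}(@lagrange_interpolation (r %% nodal)); last first.
  by rewrite -ltnS -sn ltn_modp.
rewrite poly_integral_sum; apply: eq_bigr => p _.
by rewrite poly_integralZ hornerD hornerM rn mulr0 add0r mulrC.
Qed.

(** The quadrature is exact on the square of [lagrange p], which is [1] at the
    node of index [p] and [0] at the others: the weight is the integral of this
    square. *)
Lemma gauss_weight_ge0 p : 0 <= poly_integral (lagrange p).
Proof.
suff -> : poly_integral (lagrange p) = poly_integral (lagrange p ^+ 2).
  by apply: Rintegral_ge0 => x _; rewrite horner_exp sqr_ge0.
rewrite (@gauss_quadrature (lagrange p ^+ 2)).
  rewrite (bigD1 p) //= big1 ?addr0 => [|q qp].
    by rewrite horner_exp lagrange_node eqxx expr1n mulr1.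
  by rewrite horner_exp lagrange_node (negbTE qp) expr0n mulr0.
rewrite expr2 (leq_trans (size_polyMleq _ _)) // -subn1 leq_subLR.
by rewrite (leq_trans (leq_add (size_lagrange p) (size_lagrange p))) ?leqnSn.
Qed.

End IntegralPoly.

(** * Bounded measurable functions *)

Section BoundedMeasurable.
Context {R : realType}.
Local Notation mu := (@lebesgue_measure R).
Implicit Types (A B : set R) (u w : R -> R).

(** A class stable under products, translations and restriction, and whose
    members are integrable on bounded intervals. It contains the piecewise
    polynomial functions whatever their values at the cell interfaces. *)
Definition bdmeas A u :=
  measurable_fun A u /\ exists M, forall x, A x -> `|u x| <= M.

Lemma bdmeasS A B u : measurable B -> A `<=` B -> bdmeas B u -> bdmeas A u.
Proof.
move=> mB AB [mu_ [M uM]]; split; first exact: measurable_funS mu_.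
by exists M => x /AB; exact: uM.
Qed.

Lemma bdmeasU A B u : measurable A -> measurable B ->
  bdmeas A u -> bdmeas B u -> bdmeas (A `|` B) u.
Proof.
move=> mA mB [muA [M uM]] [muB [N uN]]; split.
  by apply/measurable_funU.
exists (Num.max M N) => x [/uM|/uN] le; rewrite le_max le ?orbT //.
Qed.

Lemma bdmeas_set1 c u : bdmeas [set c] u.
Proof.
split; first exact: measurable_fun_set1.
by exists `|u c| => x ->.
Qed.

Lemma eq_bdmeas A u w : {in A, u =1 w} -> bdmeas A u -> bdmeas A w.
Proof.
move=> uw [mu_ [M uM]]; split; first exact: eq_measurable_fun mu_.
by exists M => x Ax; rewrite -uw ?inE //; exact: uM.
Qed.

Lemma bdmeas_horner (c d : R) (p : {poly R}) : bdmeas `[c, d] (horner p).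
Proof.
split; first exact: measurable_poly.
have [M pM] := poly_disk_bound p (`|c| + `|d|).
exists M => x /=; rewrite in_itv /= => /andP[cx xd]; apply: pM.
have := ler_norm d; have := ler_norm (- c); rewrite normrN.
have := normr_ge0 c; have := normr_ge0 d; rewrite ler_norml.
by move=> *; apply/andP; split; lra.
Qed.

Lemma bdmeas_restrict A u : measurable A -> bdmeas A u -> bdmeas setT (u \_ A).
Proof.
move=> mA [mu_ [M uM]]; split; first by apply/(measurable_restrictT u mA).
exists (Num.max M 0) => x _; rewrite patchE; case: ifPn => [|_].
  by rewrite inE => /uM le; rewrite le_max le.
by rewrite normr0 le_max lexx orbT.
Qed.

Lemma bdmeasM A u w : bdmeas A u -> bdmeas A w -> bdmeas A (fun x => u x * w x).
Proof.
move=> [mu_ [M uM]] [mw [N wN]]; split; first exact: measurable_funM.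
exists (M * N) => x Ax; rewrite normrM ler_pM //; [exact: uM|exact: wN].
Qed.

Lemma bdmeasZ A (t : R) u : bdmeas A u -> bdmeas A (fun x => t * u x).
Proof.
move=> bu; apply: (@bdmeasM A (cst t) u) => //; split=> //.
by exists `|t|.
Qed.

Lemma bdmeasD A u w : bdmeas A u -> bdmeas A w -> bdmeas A (fun x => u x + w x).
Proof.
move=> [mu_ [M uM]] [mw [N wN]]; split; first exact: measurable_funD.
exists (M + N) => x Ax; rewrite (le_trans (ler_normD _ _)) // lerD //.
  exact: uM.
exact: wN.
Qed.

Lemma bdmeas_comp (phi : R -> R) u : measurable_fun setT phi ->
  bdmeas setT u -> bdmeas setT (u \o phi).
Proof.
move=> mphi [mu_ [M uM]]; split; first exact: measurableT_comp.
by exists M => x _; exact: uM.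
Qed.

Lemma bdmeas_integrable u (c d : R) :
  bdmeas `[c, d] u -> mu.-integrable `[c, d] (EFin \o u).
Proof.
move=> [mu_ [M uM]]; apply: measurable_bounded_integrable => //.
  by apply: compact_finite_measure; exact: segment_compact.
exists M; split=> [|y My x /= Ax]; first exact: num_real.
by rewrite (le_trans (uM x Ax)) // ltW.
Qed.

Lemma bdmeasT_integrable u (c d : R) :
  bdmeas setT u -> mu.-integrable `[c, d] (EFin \o u).
Proof. by move=> bu; apply: bdmeas_integrable => //; apply: bdmeasS bu. Qed.

(** The codomain is the type on which the uniqueness of the Lebesgue measure is
    stated. *)
Definition translate (s : R) : measurableTypeR R -> measurableTypeR R :=
  fun x => x + s.

Lemma measurable_translate s : measurable_fun setT (translate s).
Proof. exact: measurable_funD. Qed.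

HB.instance Definition _ s :=
  isMeasurableFun.Build _ _ _ _ (translate s) (measurable_translate s).

(** Both measures agree on the intervals [`]a, b]], which generate the Borel
    sets. *)
Lemma lebesgue_measure_translate (s : R) A : measurable A ->
  pushforward mu (translate s) A = mu A.
Proof.
move=> mA; apply/esym/lebesgue_measure_unique => //= _ [[a b]] _ <-.
rewrite /pushforward /= (_ : _ @^-1` _ = `]a - s, b - s]%classic).
  rewrite !lebesgue_measure_itv /= !lte_fin ltrD2r; case: ifP => // _.
  by rewrite -!EFinD; congr (_%:E); ring.
by apply/seteqP; split=> x /=; rewrite !in_itv /= /translate ltrBlDr lerBrDr.
Qed.

Lemma Rintegral_shift u (c d s : R) : bdmeas setT u ->
  \int[mu]_(x in `[c + s, d + s]) u (x - s) = \int[mu]_(x in `[c, d]) u x.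
Proof.
move=> bu; have mEu : measurable_fun setT (EFin \o u).
  by apply/measurable_EFinP; case: bu.
have Epre : translate (- s) @^-1` `[c, d] = `[c + s, d + s]%classic.
  by apply/seteqP; split=> x /=; rewrite !in_itv /= /translate lerBrDr lerBlDr.
rewrite /Rintegral; congr fine.
have Epush : (\int[pushforward mu (translate (- s))]_(x in `[c, d]) (u x)%:E
    = \int[mu]_(x in `[c, d]) (u x)%:E)%E.
  by apply: eq_measure_integral => A mA _; exact: lebesgue_measure_translate.
apply: etrans Epush; rewrite -Epre; apply/esym.
apply: (@integral_pushforward _ _ _ _ R (translate (- s))
  (measurable_translate (- s)) mu _ (EFin \o u)) => //.
rewrite Epre; apply: bdmeasT_integrable.
apply: (@bdmeas_comp (translate (- s))) => //.
exact: measurable_translate.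
Qed.

Lemma Rintegral_itv_cat u (c d e : R) : bdmeas `[c, e] u -> c <= d -> d <= e ->
  \int[mu]_(x in `[c, e]) u x =
  \int[mu]_(x in `[c, d]) u x + \int[mu]_(x in `[d, e]) u x.
Proof.
move=> bu cd de.
have iu := bdmeas_integrable bu.
have := @Rintegral_itvB _ u (BLeft c) (BRight e) d iu.
rewrite !bnd_simp => /(_ cd de) /eqP; rewrite subr_eq addrC => /eqP ->.
rewrite Rintegral_itv_obnd_cbnd //; apply: integrableS iu => //.
by apply: subset_itvr; rewrite bnd_simp.
Qed.

End BoundedMeasurable.

Section IntervalIntegrals.
Context {R : realType}.
Local Notation mu := (@lebesgue_measure R).

Lemma eq_Rintegral_interior (c d : R) (u w : R -> R) :
  bdmeas `[c, d] u -> bdmeas `[c, d] w -> {in `]c, d[, u =1 w} ->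
  \int[mu]_(x in `[c, d]) u x = \int[mu]_(x in `[c, d]) w x.
Proof.
have open_closed z : bdmeas `[c, d] z ->
    \int[mu]_(x in `]c, d[) z x = \int[mu]_(x in `[c, d]) z x.
  move=> bz; have iz := bdmeas_integrable bz.
  rewrite Rintegral_itv_bndo_bndc; last first.
    by apply: integrableS iz => //; apply: subset_itv; rewrite bnd_simp.
  rewrite Rintegral_itv_obnd_cbnd //.
  by apply: integrableS iz => //; apply: subset_itv; rewrite bnd_simp.
move=> bu bw uw; rewrite -open_closed // -[RHS]open_closed //.
by apply: eq_Rintegral => x; rewrite inE => /uw.
Qed.

(** Translating by a multiple of [L], one may assume that [c] lies in [0, L[;
    the part of [c, c + L] beyond [L] is then moved back to [0, c]. *)
Lemma Rintegral_periodic (L c : R) (h : R -> R) : 0 < L -> bdmeas setT h ->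
  (forall (m : int) x, h (x + m%:~R * L) = h x) ->
  \int[mu]_(x in `[c, c + L]) h x = \int[mu]_(x in `[0, L]) h x.
Proof.
move=> L0 bh hper.
have bhA A : bdmeas A h by apply: bdmeasS bh.
have shift (m : int) p q :
    \int[mu]_(x in `[p + m%:~R * L, q + m%:~R * L]) h x =
    \int[mu]_(x in `[p, q]) h x.
  rewrite -(Rintegral_shift p q (m%:~R * L)) //; apply: eq_Rintegral => x _.
  by rewrite -[in RHS](hper m) subrK.
pose m := Num.floor (c / L); pose r := c - m%:~R * L.
have r0 : 0 <= r by rewrite subr_ge0 -ler_pdivlMr // floor_le.
have rL : r <= L.
  rewrite lerBlDr -[X in _ <= X + _]mul1r -mulrDl -ler_pdivrMr // addrC ltW //.
  by rewrite -[1]/(1%:~R) -intrD floorD1_gt.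
have -> : c = r + m%:~R * L by rewrite subrK.
rewrite [_ + L]addrAC shift (@Rintegral_itv_cat _ _ _ L) ?lerDr //.
have -> : \int[mu]_(x in `[L, (r + L)]) h x = \int[mu]_(x in `[0, r]) h x.
  by rewrite -(shift 1 0 r) mul1r add0r.
by rewrite addrC -Rintegral_itv_cat.
Qed.

End IntervalIntegrals.

(** * Piecewise polynomial functions on a mesh *)

Section Mesh.
Context {R : realType}.
Local Notation mu := (@lebesgue_measure R).
Context {k : nat} {a b : R} (G : gl_mesh k a b).

Lemma pt_le i j : (i <= j)%N -> (j <= ncell G)%N -> pt G i <= pt G j.
Proof.
elim: j => [|j IHj]; first by rewrite leqn0 => /eqP ->.
rewrite leq_eqVlt ltnS => /predU1P[-> //|leij] ltjn.
by rewrite (le_trans (IHj leij (ltnW ltjn))) // ltW // (pt_lt (Ordinal ltjn)).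
Qed.

Lemma pt_ge_first i : (i <= ncell G)%N -> a <= pt G i.
Proof. by move=> le; rewrite -[leLHS](pt_first G) pt_le. Qed.

Lemma pt_le_last i : (i <= ncell G)%N -> pt G i <= b.
Proof. by move=> le; rewrite -[leRHS](pt_last G) pt_le. Qed.

Lemma cell_sub (i : 'I_(ncell G)) x :
  x \in `[pt G i, pt G i.+1] -> x \in `[a, b].
Proof.
rewrite !in_itv /= => /andP[lo hi].
rewrite (le_trans (pt_ge_first (ltnW (ltn_ord i))) lo).
by rewrite (le_trans hi) // pt_le_last.
Qed.

Lemma open_cell_sub (i : 'I_(ncell G)) x :
  x \in `]pt G i, pt G i.+1[ -> x \in `[a, b].
Proof. by move=> xi; apply: (@cell_sub i); exact: subset_itv_oo_cc xi. Qed.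

Lemma node_in_mesh (i : 'I_(ncell G)) p : node i p \in `[a, b].
Proof. exact/open_cell_sub/node_in. Qed.

(** [in_D G] is [pwpoly k.+1]; larger sizes are needed for squares. *)
Definition pwpoly n (u : R -> R) := forall i : 'I_(ncell G),
  exists p : {poly R}, (size p <= n)%N /\
    forall x, x \in `]pt G i, pt G i.+1[ -> u x = p.[x].

Lemma pwpolyD n u w :
  pwpoly n u -> pwpoly n w -> pwpoly n (fun x => u x + w x).
Proof.
move=> hu hw i; have [p [sp up]] := hu i; have [q [sq wq]] := hw i.
exists (p + q); split.
  by rewrite (leq_trans (size_polyD _ _)) // geq_max sp.
by move=> x xi; rewrite up // wq // hornerD.
Qed.

Lemma pwpolyZ n t u : pwpoly n u -> pwpoly n (fun x => t * u x).
Proof.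
move=> hu i; have [p [sp up]] := hu i.
exists (t *: p); split; first exact: leq_trans (size_scale_leq _ _) sp.
by move=> x xi; rewrite up // hornerZ.
Qed.

Lemma pwpoly_sum n (I : finType) (F : I -> R -> R) :
  (forall i, pwpoly n (F i)) -> pwpoly n (fun x => \sum_i F i x).
Proof.
move=> hF; have -> : (fun x => \sum_i F i x) = \sum_i F i.
  by apply/funext => x; rewrite fct_sumE.
apply: big_ind => [i|u w|i _]; last exact: hF; last exact: pwpolyD.
by exists 0; split=> [|x _]; rewrite ?size_poly0 ?horner0.
Qed.

Lemma pwpoly_sqr n u : pwpoly n u -> pwpoly (n + n) (fun x => u x ^+ 2).
Proof.
move=> hu i; have [p [sp up]] := hu i; exists (p ^+ 2); split.
  rewrite expr2 (leq_trans (size_polyMleq _ _)) //.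
  by rewrite (leq_trans (leq_pred _)) ?leq_add.
by move=> x xi; rewrite up // horner_exp.
Qed.

Lemma pwpoly_bdmeas n u : pwpoly n u -> bdmeas `[a, b] u.
Proof.
move=> hu; suff H m : (m <= ncell G)%N -> bdmeas `[pt G 0, pt G m] u.
  by have := H _ (leqnn _); rewrite pt_first pt_last.
elim: m => [|m IHm] ltmn; first by rewrite set_itv1; exact: bdmeas_set1.
have lt01 := pt_lt (Ordinal ltmn).
have -> : `[pt G 0, pt G m.+1]%classic =
    `[pt G 0, pt G m] `|` (`]pt G m, pt G m.+1[ `|` [set pt G m.+1]).
  rewrite setUitv1 ?bnd_simp //.
  by rewrite -itv_bndbnd_setU // bnd_simp ?pt_le // ltnW.
have [p [_ up]] := hu (Ordinal ltmn).
apply: bdmeasU => //; first by apply: measurableU.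
  exact/IHm/ltnW.
apply: bdmeasU => //; last exact: bdmeas_set1.
apply: (@eq_bdmeas _ _ (horner p)) => [x|].
  by rewrite inE => /up ->.
apply: bdmeasS (bdmeas_horner (pt G m) (pt G m.+1) p) => //.
by apply: subset_itv; rewrite bnd_simp.
Qed.

Lemma Rintegral_cells (s : R) (h : R -> R) : bdmeas `[a + s, b + s] h ->
  \int[mu]_(x in `[a + s, b + s]) h x =
  \sum_(i < ncell G) \int[mu]_(x in cell_shift s i) h x.
Proof.
move=> bh; suff H m : (m <= ncell G)%N ->
    \int[mu]_(x in `[pt G 0 + s, pt G m + s]) h x =
    \sum_(i < m) \int[mu]_(x in `[pt G i + s, pt G i.+1 + s]) h x.
  by have := H _ (leqnn _); rewrite pt_first pt_last.
elim: m => [|m IHm] ltmn.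
  by rewrite big_ord0 set_itv1 Rintegral_set1.
rewrite big_ord_recr /= -IHm ?(ltnW ltmn) // -Rintegral_itv_cat //.
- apply: bdmeasS bh => //.
  by apply: subset_itv; rewrite bnd_simp lerD2r ?pt_first ?pt_le_last.
- by rewrite lerD2r pt_le // ltnW.
- by rewrite lerD2r pt_le.
Qed.

Lemma Rintegral_cell (i : 'I_(ncell G)) (r : {poly R}) :
  (size r <= k.+1 + k.+1)%N ->
  \int[mu]_(x in cell i) r.[x] = \sum_p weight i p * r.[node i p].
Proof.
move=> sr.
rewrite -/(poly_integral (pt G i) (pt G i.+1) r).
rewrite (gauss_quadrature (pt_lt i) (node_inj (i:=i)) (node_root i)) //.
apply: eq_bigr => p _; congr (_ * _).
by apply: eq_Rintegral => x _; rewrite horner_lagrange.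
Qed.

Lemma weight_ge0 (i : 'I_(ncell G)) p : 0 <= weight i p.
Proof.
have := gauss_weight_ge0 (pt_lt i) (node_inj (i:=i)) (node_root i) p.
by rewrite /poly_integral; under eq_Rintegral do rewrite horner_lagrange.
Qed.

(** The interfaces are negligible, and [gauss_quadrature] applies inside each
    cell. *)
Lemma quadrature u : pwpoly (k.+1 + k.+1) u ->
  \int[mu]_(x in `[a, b]) u x =
  \sum_(n : 'I_(ncell G) * 'I_k.+1) weight n.1 n.2 * u (node n.1 n.2).
Proof.
move=> hu; have bu := pwpoly_bdmeas hu.
rewrite -(pair_bigA _ (fun i p => weight i p * u (node i p))) /=.
have := @Rintegral_cells 0 u; rewrite !addr0 => -> //; apply: eq_bigr => i _.
have [r [sr ur]] := hu i.
under eq_bigr do rewrite ur ?node_in //.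
rewrite -Rintegral_cell // /cell_shift !addr0.
apply: eq_Rintegral_interior => //.
- apply: bdmeasS bu => //; apply: subset_itv; rewrite bnd_simp.
    exact/pt_ge_first/ltnW.
  exact: pt_le_last.
- exact: bdmeas_horner.
Qed.

(** The hypothesis is the definition of the projection [g] of a translate of
    [h], tested with [g] itself. On each cell, [h(x) g(x - s)] is at most
    [(h(x)^2 + g(x - s)^2) / 2] and the integral of [g(x - s)^2] over the
    translated cell is that of [g^2] over the cell, so that half of the latter
    can be absorbed in the left-hand side. *)
Lemma projection_contraction (s : R) (g h : R -> R) :
  in_D G g -> bdmeas setT h ->
  (forall i : 'I_(ncell G), \int[mu]_(x in cell i) (g x * g x) =
             \int[mu]_(x in cell_shift s i) (h x * g (x - s))) ->
  \int[mu]_(x in `[a, b]) g x ^+ 2 <=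
  \int[mu]_(x in `[a + s, b + s]) h x ^+ 2.
Proof.
move=> Dg bh proj; have bg : bdmeas `[a, b] g := pwpoly_bdmeas Dg.
(* [g] is arbitrary outside [a, b], hence possibly not measurable there. *)
pose g0 := g \_ `[a, b]; have bg0 : bdmeas setT g0 by exact: bdmeas_restrict.
have in_ab (i : 'I_(ncell G)) x : x \in `[pt G i, pt G i.+1] -> g0 x = g x.
  by move=> /cell_sub xab; rewrite /g0 patchE mem_set.
have bsq (w : R -> R) : bdmeas setT w -> bdmeas setT (fun x => w x ^+ 2).
  by move=> bw; apply: (@bdmeasM _ setT w w).
have b2 : bdmeas `[a, b] (fun x => g x ^+ 2) by exact: (@bdmeasM _ _ g g).
have := @Rintegral_cells 0 (fun x => g x ^+ 2); rewrite !addr0 => -> //.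
rewrite (@Rintegral_cells s (fun x => h x ^+ 2)); last first.
  by apply: bdmeasS (bsq _ bh).
apply: ler_sum => i _; rewrite /cell_shift !addr0.
set c := pt G i; set d := pt G i.+1.
set A := Rintegral _ _ _; set B := Rintegral _ _ _.
have bshift : bdmeas setT (fun x => g0 (x - s)).
  by apply: (@bdmeas_comp _ (fun x => x - s)) => //; exact: measurable_funD.
have EA : \int[mu]_(x in `[c + s, d + s]) g0 (x - s) ^+ 2 = A.
  rewrite (@Rintegral_shift _ (fun x => g0 x ^+ 2)); last exact: bsq.
  by apply: eq_Rintegral => x; rewrite inE => /in_ab ->.
have AE : A = \int[mu]_(x in `[c + s, d + s]) (h x * g0 (x - s)).
  rewrite -[LHS]/(\int[mu]_(x in cell i) (g x * g x)) proj.
  apply: eq_Rintegral => x; rewrite inE /= => xcd; congr (_ * _).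
  apply/esym/(in_ab i); move: xcd; rewrite !in_itv /=.
  by rewrite lerBrDr lerBlDr.
have bh2 := bdmeasZ 2^-1 (bsq _ bh).
have bs2 := bdmeasZ 2^-1 (bsq _ bshift).
have leA : A <= 2^-1 * B + 2^-1 * A.
  rewrite {1}AE -EA /B.
  rewrite -!RintegralZl //; try by apply: bdmeasT_integrable; exact: bsq.
  rewrite -RintegralD //; try exact: bdmeasT_integrable.
  apply: le_Rintegral => //.
  - by apply: bdmeasT_integrable; exact: bdmeasM.
  - by apply: bdmeasT_integrable; exact: (bdmeasD bh2 bs2).
  by move=> x _; have := sqr_ge0 (h x - g0 (x - s)); rewrite sqrrB; lra.
lra.
Qed.

End Mesh.

(** * Periodic extension and extension by zero *)

Section Extensions.
Context {R : realType}.
Local Notation mu := (@lebesgue_measure R).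
Implicit Type u : R -> R.

Lemma periodic_ext_periodic (L : R) u (m : int) x : 0 < L ->
  periodic_ext L u (x + m%:~R * L) = periodic_ext L u x.
Proof.
move=> L0; rewrite /periodic_ext; congr u.
rewrite mulrDl mulfK ?gt_eqF // floorDrz ?intr_int // intrKfloor intrD; ring.
Qed.

Lemma periodic_ext_id (L : R) u x : x \in `]0, L[ -> periodic_ext L u x = u x.
Proof.
rewrite in_itv /= => /andP[x0 xL]; rewrite /periodic_ext.
suff -> : Num.floor (x / L) = 0 by rewrite mul0r subr0.
have L0 := lt_trans x0 xL.
apply/eqP; rewrite floor_eq add0r divr_ge0 ?(ltW x0) ?(ltW L0) //=.
by rewrite ltr_pdivrMr // mul1r.
Qed.

(** The periodic extension is [u], restricted to [0, L], composed with the
    reduction modulo [L]; the latter is measurable because [floor] is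
    monotone. *)
Lemma periodic_ext_bdmeas (L : R) u : 0 < L -> bdmeas `[0, L] u ->
  bdmeas setT (periodic_ext L u).
Proof.
move=> L0 bu; pose phi (x : R) := x - (Num.floor (x / L))%:~R * L.
have mphi : measurable_fun setT phi.
  apply: measurable_funB => //; apply: measurable_funM => //.
  apply: nondecreasing_measurable => // x y xy.
  by rewrite ler_int le_floor // ler_pM2r ?invr_gt0.
have -> : periodic_ext L u = (u \_ `[0, L]) \o phi.
  apply/funext => x; rewrite /= patchE mem_set //= in_itv /= /phi.
  have /andP[le lt] := floor_itv (x / L).
  rewrite subr_ge0 -ler_pdivlMr // le /= lerBlDr.
  rewrite -[X in X + _]mul1r -mulrDl -ler_pdivrMr // ltW // addrC.
  by rewrite -[1]/(1%:~R) -intrD.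
exact/(bdmeas_comp mphi)/bdmeas_restrict.
Qed.

Lemma Rintegral_periodic_ext_sqr (L c : R) u : 0 < L -> bdmeas `[0, L] u ->
  \int[mu]_(x in `[c, c + L]) periodic_ext L u x ^+ 2 =
  \int[mu]_(x in `[0, L]) u x ^+ 2.
Proof.
move=> L0 bu; have bp := periodic_ext_bdmeas L0 bu.
have bp2 : bdmeas setT (fun x => periodic_ext L u x ^+ 2).
  exact: (bdmeasM bp bp).
rewrite (Rintegral_periodic c L0 bp2); last first.
  by move=> m x; rewrite periodic_ext_periodic.
apply: eq_Rintegral_interior; first exact: bdmeasS bp2.
  exact: (bdmeasM bu bu).
by move=> x /periodic_ext_id ->.
Qed.

Lemma zero_extE (vm : R) u : zero_ext vm u = u \_ `[- vm, vm].
Proof. by apply/funext => v; rewrite /zero_ext patchE mem_setE. Qed.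

Lemma Rintegral_zero_ext_sqr_le (vm c d : R) u : bdmeas `[- vm, vm] u ->
  \int[mu]_(v in `[c, d]) zero_ext vm u v ^+ 2 <=
  \int[mu]_(v in `[- vm, vm]) u v ^+ 2.
Proof.
move=> bu; have bu2 : bdmeas `[- vm, vm] (fun v => u v ^+ 2).
  exact: (bdmeasM bu bu).
have -> : (fun v => zero_ext vm u v ^+ 2) = (fun v => u v ^+ 2) \_ `[- vm, vm].
  apply/funext => v; rewrite zero_extE !patchE; case: ifP => // _.
  by rewrite expr0n.
rewrite -Rintegral_mkcondr Rintegral_mkcondl.
have brest : bdmeas `[- vm, vm] ((fun v => u v ^+ 2) \_ `[c, d]).
  split; first by apply/measurable_restrict => //; apply: measurable_funS bu2.1.
  have [M uM] := bu2.2; exists M => v /uM; apply: le_trans.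
  by rewrite patchE; case: ifP => // _; rewrite normr0.
apply: le_Rintegral => //; [exact: bdmeas_integrable..|].
by move=> v _; rewrite patchE; case: ifP => // _; exact: sqr_ge0.
Qed.

End Extensions.

(** * Contraction property of the substeps *)

Section Stability.
Context {R : realType} {k : nat} {L vm : R}.
Hypothesis L0 : 0 < L.
Variables (X : gl_mesh k 0 L) (V : gl_mesh k (- vm) vm) (dt : R).
Local Notation mu := (@lebesgue_measure R).
Implicit Types f g : R -> R -> R.

Lemma in_Q_line_x f v : in_Q X V f -> v \in `[- vm, vm] -> in_D X (f ^~ v).
Proof.
move=> [n [u [w [Du _ Ef]]]] vV i.
have [p [sp up]] := pwpoly_sum (fun l => pwpolyZ (w l v) (Du l)) i.
exists p; split=> // x xi; rewrite -up // Ef ?(open_cell_sub xi) //.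
by apply: eq_bigr => l _; rewrite mulrC.
Qed.

Lemma in_Q_line_v f x : in_Q X V f -> x \in `[0, L] -> in_D V (f x).
Proof.
move=> [n [u [w [_ Dw Ef]]]] xX j.
have [p [sp up]] := pwpoly_sum (fun l => pwpolyZ (u l x) (Dw l)) j.
by exists p; split=> // v vj; rewrite -up // Ef ?(open_cell_sub vj).
Qed.

Lemma quadrature_line_x f v : in_Q X V f -> v \in `[- vm, vm] ->
  \int[mu]_(x in `[0, L]) f x v ^+ 2 =
  \sum_(m : 'I_(ncell X) * 'I_k.+1) weight m.1 m.2 * f (node m.1 m.2) v ^+ 2.
Proof.
move=> Qf vV.
exact: (quadrature (pwpoly_sqr (in_Q_line_x Qf vV))).
Qed.

Lemma quadrature_line_v f x : in_Q X V f -> x \in `[0, L] ->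
  \int[mu]_(v in `[- vm, vm]) f x v ^+ 2 =
  \sum_(n : 'I_(ncell V) * 'I_k.+1) weight n.1 n.2 * f x (node n.1 n.2) ^+ 2.
Proof.
move=> Qf xX.
exact: (quadrature (pwpoly_sqr (in_Q_line_v Qf xX))).
Qed.

Definition L2sq f := \int[mu]_(x in `[0, L])
  \int[mu]_(v in `[- vm, vm]) (`|f x v| ^+ 2).

(** The inner integral is, as a function of [x], a combination of squares of
    elements of [in_D X]: the quadrature in [x] is exact on it too. *)
Lemma L2sq_lines_v f : in_Q X V f ->
  L2sq f = \sum_(m : 'I_(ncell X) * 'I_k.+1) weight m.1 m.2 *
    \int[mu]_(v in `[- vm, vm]) f (node m.1 m.2) v ^+ 2.
Proof.
move=> Qf; rewrite /L2sq.
under eq_bigr => m _ do rewrite quadrature_line_v ?node_in_mesh //.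
rewrite -[RHS](quadrature (u := fun x =>
  \sum_(n : 'I_(ncell V) * 'I_k.+1) weight n.1 n.2 * f x (node n.1 n.2) ^+ 2)).
  apply: eq_Rintegral => x; rewrite inE /= => xX.
  under eq_Rintegral do rewrite real_normK ?num_real //.
  exact: quadrature_line_v.
apply: pwpoly_sum => n; apply/pwpolyZ/pwpoly_sqr/in_Q_line_x => //.
exact: node_in_mesh.
Qed.

(** Both sides are the same double quadrature sum, in either order of
    summation. *)
Lemma L2sq_lines_x f : in_Q X V f ->
  L2sq f = \sum_(n : 'I_(ncell V) * 'I_k.+1) weight n.1 n.2 *
    \int[mu]_(x in `[0, L]) f x (node n.1 n.2) ^+ 2.
Proof.
move=> Qf; rewrite L2sq_lines_v //.
under eq_bigr => m _ do rewrite quadrature_line_v ?node_in_mesh // mulr_sumr.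
under [RHS]eq_bigr => n _ do
  rewrite quadrature_line_x ?node_in_mesh // mulr_sumr.
rewrite exchange_big; apply: eq_bigr => n _; apply: eq_bigr => m _.
by rewrite mulrCA.
Qed.

(** On the line [v = v_jq] the translation is by [- v_jq * dt / 2]; the
    translated domain is one period of the extension. *)
Lemma x_step_contraction f g : in_Q X V f -> x_step X V dt f g ->
  L2sq g <= L2sq f.
Proof.
move=> Qf [Qg proj]; rewrite !L2sq_lines_x //; apply: ler_sum => -[j q] _ /=.
rewrite ler_wpM2l ?weight_ge0 //.
set v := node j q; have vV : v \in `[- vm, vm] by exact: node_in_mesh.
have bf := pwpoly_bdmeas (in_Q_line_x Qf vV).
set s := v * dt / 2.
rewrite -(Rintegral_periodic_ext_sqr (- s) L0 bf).
have -> : `[- s, - s + L]%classic = `[0 - s, L - s]%classic :> set R.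
  by rewrite add0r addrC.
apply: (@projection_contraction _ _ _ _ X (- s) (g ^~ v)
  (periodic_ext L (f ^~ v))) => [||i].
- exact: in_Q_line_x.
- exact: periodic_ext_bdmeas.
- by rewrite opprK; exact: (proj j q i _ (in_Q_line_x Qg vV)).
Qed.

(** The integral of the squared extension by zero over the translated domain is
    at most the integral of the square over the velocity domain. *)
Lemma v_step_contraction Eh f g : in_Q X V f -> v_step X V dt Eh f g ->
  L2sq g <= L2sq f.
Proof.
move=> Qf [Qg proj]; rewrite !L2sq_lines_v //; apply: ler_sum => -[i p] _ /=.
rewrite ler_wpM2l ?weight_ge0 //.
set x := node i p; have xX : x \in `[0, L] by exact: node_in_mesh.
have bf := pwpoly_bdmeas (in_Q_line_v Qf xX).
pose s := Eh x * dt.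
apply: le_trans (Rintegral_zero_ext_sqr_le (- vm + s) (vm + s) bf).
apply: (@projection_contraction _ _ _ _ V s (g x) (zero_ext vm (f x)))
  => [||j].
- exact: in_Q_line_v.
- by rewrite zero_extE; exact: bdmeas_restrict.
- exact: (proj i p j _ (in_Q_line_v Qg xX)).
Qed.

Lemma ecsldg_step_contraction lam f E f' E' : in_Q X V f ->
  ecsldg_step X V lam dt f E f' E' -> L2sq f' <= L2sq f.
Proof.
move=> Qf [fs [fss [step1 _ _ step2 step3]]].
have := x_step_contraction Qf step1.
apply: le_trans; have := v_step_contraction step1.1 step2; apply: le_trans.
exact: x_step_contraction step2.1 step3.
Qed.

Lemma ecsldg_run_in_Q lam M (f : nat -> R -> R -> R) E m :
  ecsldg_run X V lam dt M f E ->
  (m <= M)%N -> in_Q X V (f m).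
Proof.
move=> [Q0 _ step]; case: m => // m /step [fs [fss [_ _ _ _ step3]]].
exact: step3.1.
Qed.

End Stability.

Theorem proposition3p4 (R : realType) (k : nat) (L vm lam dt : R)
    (hL : 0 < L) (hvm : 0 < vm) (hlam : 0 < lam) (hdt : 0 < dt)
    (X : gl_mesh k 0 L) (V : gl_mesh k (- vm) vm)
    (M : nat) (f : nat -> R -> R -> R) (E : nat -> R -> R)
    (hrun : ecsldg_run X V lam dt M f E) :
  forall m : nat, (m < M)%N ->
    \int[@lebesgue_measure R]_(x in `[0, L])
      \int[@lebesgue_measure R]_(v in `[- vm, vm]) (`|f m.+1 x v| ^+ 2)
    <= \int[@lebesgue_measure R]_(x in `[0, L])
         \int[@lebesgue_measure R]_(v in `[- vm, vm]) (`|f m x v| ^+ 2).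
Proof.
move=> m ltmM; have Qf := ecsldg_run_in_Q hrun (ltnW ltmM).
have [_ _ /(_ m ltmM) step] := hrun.
exact: (ecsldg_step_contraction hL Qf step).
Qed.
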